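(* Let $k$ be a commutative ring, let $(\mathfrak{a},\mu)$ be a $cA_\infty$-category over $k$ and let $\phi\in\mathbf{C}^2(\mathfrak{a})$ be a Hochschild cocycle. After identifying the object $(A,\psi_A)$ of $\mathfrak{a}^{tot}_\phi[\epsilon]$ with the object $(A,\psi_A\epsilon)$ of $(\mathfrak{a}_\phi[\epsilon])_{\Psi\epsilon}$, one has an equality of $cA_\infty$-categories over $k[\epsilon]$ $$\mathfrak{a}^{tot}_\phi[\epsilon]=\bigl((\mathfrak{a}_\phi[\epsilon])_{\Psi\epsilon},\ \mathrm{embr}_{\psi\epsilon}(\mu+\phi\epsilon)\bigr).$$
   Context: A $k$-quiver $\mathfrak{a}$ has a set of objects and $\mathbb{Z}$-graded $k$-modules $\mathfrak{a}(A,A')$; $(\Sigma V)^n=V^{n+1}$. The Hochschild object is $\mathbf{C}(\mathfrak{a})=\Sigma^{-1}\mathbf{C}_{br}(\mathfrak{a})$ with $\mathbf{C}_{br}(\mathfrak{a})=\prod_{n\ge 0}\prod_{A_0,\dots,A_n}\mathrm{Hom}_k(\Sigma\mathfrak{a}(A_{n-1},A_n)\otimes\dots\otimes\Sigma\mathfrak{a}(A_0,A_1),\Sigma\mathfrak{a}(A_0,A_n))$. The factor $n=0$ is the zero part; an element of $\mathbf{C}^1(\mathfrak{a})_0$ is a family $\psi_A\in\mathfrak{a}(A,A)^1$. Braces: $\phi\{\phi_1,\dots,\phi_m\}=\sum\phi(1\otimes\dots\otimes\phi_1\otimes1\dots\otimes\phi_m\otimes\dots\otimes1)$ (Koszul signs).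 A $cA_\infty$-structure is $\mu\in\mathbf{C}^2(\mathfrak{a})$ with $\mu\{\mu\}=0$. The Hochschild differential is $d_{Hoch}=[\mu,-]$, with $[\phi,\psi]=\phi\{\psi\}-(-1)^{|\phi||\psi|}\psi\{\phi\}$ (degrees in $\mathbf{C}_{br}$). $k[\epsilon]$ is the ring of dual numbers, $\epsilon^2=0$, $\epsilon$ in degree 0. For a Hochschild 2-cocycle $\phi$, the linear deformation is the $k[\epsilon]$-linear $cA_\infty$-category $\mathfrak{a}_\phi[\epsilon]=(\mathfrak{a}\oplus\mathfrak{a}\epsilon,\mu+\phi\epsilon)$ with the same objects as $\mathfrak{a}$. For a family of sets $\Psi=(\Psi_A)_A$ with $\Psi_A\subseteq\mathfrak{a}(A,A)^1$, the quiver $\mathfrak{a}_\Psi$ has objects $(A,\psi_A)$, $\psi_A\in\Psi_A$, and $\mathfrak{a}_\Psi((A,\psi_A),(B,\psi_B))=\mathfrak{a}(A,B)$; Hochschild elements of $\mathfrak{a}$ extend trivially to $\mathfrak{a}_\Psi$. There is a tautological $\psi\in\mathbf{C}^1(\mathfrak{a}_\Psi)_0$ with component $\psi_A$ at $(A,\psi_A)$. Total deformation: take $\Psi_A=\mathfrak{a}(A,A)^1$ and put $\mathfrak{a}_\phi^{tot}[\epsilon]=(\mathfrak{a}_\Psi)_{\phi+\mu\{\psi\}}[\epsilon]$, i.e. the linear deformation of $\mathfrak{a}_\Psi$ along the cocycle $\phi+d_{Hoch}(\psi)=\phi+\mu\{\psi\}$. Twisted variant: $(\Psi\epsilon)_A=\mathfrak{a}(A,A)^1\epsilon\subseteq\mathfrak{a}_\phi[\epsilon](A,A)^1$;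 $(\mathfrak{a}_\phi[\epsilon])_{\Psi\epsilon}$ has objects $(A,\psi_A\epsilon)$ and the Hom-modules of $\mathfrak{a}_\phi[\epsilon]$; $\psi\epsilon$ is the tautological element of its zero part, and $\mathrm{embr}_{\psi\epsilon}(\nu)=\sum_{m\ge0}\nu\{(\psi\epsilon)^{\otimes m}\}$. *)

(* Defs.v *)
From HB Require Import structures.
From mathcomp Require Import all_boot all_order all_algebra.
From mathcomp Require Import boolp classical_sets cardinality fsbigop.

Set Implicit Arguments.
Unset Strict Implicit.
Unset Printing Implicit Defensive.

Import GRing.Theory.

Local Open Scope classical_set_scope.
Local Open Scope ring_scope.

(** [dual T] is the set of formal sums [x + y eps].  For a commutative ring [k]
    it is the ring [k[eps]], and for a [k]-module [V] it is the [k[eps]]-module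
    [V[eps] = V (+) V eps]. *)

Record dual (T : Type) := Dual { re : T; ep : T }.

Section DualChoice.
Variable T : choiceType.
Definition dual_pair (u : dual T) : T * T := (re u, ep u).
Definition pair_dual (p : T * T) : dual T := Dual p.1 p.2.
Lemma dual_pairK : cancel dual_pair pair_dual. Proof. by case. Qed.
HB.instance Definition _ := Choice.copy (dual T) (can_type dual_pairK).
End DualChoice.

Section DualZmodule.
Variable V : zmodType.
Definition dual_zero : dual V := Dual 0 0.
Definition dual_opp (u : dual V) : dual V := Dual (- re u) (- ep u).
Definition dual_add (u v : dual V) : dual V := Dual (re u + re v) (ep u + ep v).
Lemma dual_addA : associative dual_add.
Proof. by move=> u v w; rewrite /dual_add /= !addrA. Qed.
Lemma dual_addC : commutative dual_add.
Proof. by move=> u v; rewrite /dual_add addrC [ep u + _]addrC. Qed.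
Lemma dual_add0 : left_id dual_zero dual_add.
Proof. by case=> x y; rewrite /dual_add /= !add0r. Qed.
Lemma dual_addN : left_inverse dual_zero dual_opp dual_add.
Proof. by case=> x y; rewrite /dual_add /= !addNr. Qed.
HB.instance Definition _ :=
  GRing.isZmodule.Build (dual V) dual_addA dual_addC dual_add0 dual_addN.
End DualZmodule.

Section DualRing.
Variable k : comPzRingType.
Definition dual_one : dual k := Dual 1 0.
Definition dual_mul (u v : dual k) : dual k :=
  Dual (re u * re v) (re u * ep v + ep u * re v).
Lemma dual_mulA : associative dual_mul.
Proof.
by move=> u v w; rewrite /dual_mul /= !mulrA mulrDl mulrDr !mulrA !addrA.
Qed.
Lemma dual_mulC : commutative dual_mul.
Proof.
move=> u v; rewrite /dual_mul addrC mulrC.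
by rewrite [ep u * _]mulrC [re u * ep v]mulrC.
Qed.
Lemma dual_mul1 : left_id dual_one dual_mul.
Proof. by case=> x y; rewrite /dual_mul /= !mul1r mul0r addr0. Qed.
Lemma dual_mulDl : left_distributive dual_mul +%R.
Proof.
by move=> u v w; rewrite /dual_mul; congr Dual; rewrite /= !mulrDl // addrACA.
Qed.
HB.instance Definition _ := GRing.Zmodule_isComPzRing.Build (dual k)
  dual_mulA dual_mulC dual_mul1 dual_mulDl.
End DualRing.

Section DualModule.
Variables (k : comPzRingType) (V : lmodType k).
Definition dual_scale (c : dual k) (u : dual V) : dual V :=
  Dual (re c *: re u) (re c *: ep u + ep c *: re u).
Lemma dual_scaleA c d u :
  dual_scale c (dual_scale d u) = dual_scale (c * d) u.
Proof.
by rewrite /dual_scale /= !scalerDl scalerDr !scalerA !addrA.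
Qed.
Lemma dual_scale1 : left_id 1 dual_scale.
Proof. by case=> x y; rewrite /dual_scale /= !scale1r scale0r addr0. Qed.
Lemma dual_scaleDr : right_distributive dual_scale +%R.
Proof.
move=> c u v; rewrite /dual_scale; congr Dual; rewrite /= !scalerDr //.
by rewrite addrACA.
Qed.
Lemma dual_scaleDl u : {morph dual_scale^~ u : c d / c + d}.
Proof.
move=> c d; rewrite /dual_scale; congr Dual; rewrite /= !scalerDl //.
by rewrite addrACA.
Qed.
HB.instance Definition _ := GRing.Zmodule_isLmodule.Build (dual k) (dual V)
  dual_scaleA dual_scale1 dual_scaleDr dual_scaleDl.
End DualModule.

Definition epsilon (k : comPzRingType) : dual k := Dual 0 1.
Definition times_eps (V : zmodType) (x : V) : dual V := Dual 0 x.

Record quiver (k : comPzRingType) := Quiver {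
  ob :> Type;
  qhom : ob -> ob -> int -> lmodType k }.
Arguments qhom {k} q _ _ _.

(* The shift: (Sigma V)^n = V^(n+1). *)
Definition susp (k : comPzRingType) (V : int -> lmodType k) : int -> lmodType k :=
  fun n => V (n + 1).

(* Elements of [str a A B] with A = A_0 and B = A_n are the composable strings
   x_n (x) ... (x) x_1 of homogeneous elements x_i of Sigma a(A_(i-1), A_i);
   the leftmost factor x_n is the head of the string. *)
Inductive str (k : comPzRingType) (a : quiver k) : a -> a -> Type :=
| snil A : str A A
| scons A B C i : susp (qhom a B C) i -> str A B -> str A C.
Arguments str {k} a _ _.
Arguments snil {k a} A.
Arguments scons {k a A B C i} _ _.

Section Cochains.
Variables (k : comPzRingType) (a : quiver k).

Fixpoint sdeg (A B : a) (x : str a A B) : int :=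
  match x with
  | snil _ => 0
  | scons _ _ _ i _ s => i + sdeg s
  end.

Fixpoint scat (A B C : a) (x : str a B C) : str a A B -> str a A C :=
  match x in str _ B C return str a A B -> str a A C with
  | snil _ => id
  | scons _ _ _ _ h s => fun y => scons h (scat s y)
  end.

(* All factorizations x = u (x) v, with u or v possibly empty. *)
Fixpoint splits (A C : a) (x : str a A C) :
    seq {B : a & (str a B C * str a A B)%type} :=
  match x in str _ A C return seq {B : a & (str a B C * str a A B)%type} with
  | snil A => [:: existT _ A (snil A, snil A)]
  | scons A B C i h s => existT _ C (snil C, scons h s) ::
      [seq existT (fun D => (str a D C * str a A D)%type)
             (tag p) (scons h (tagged p).1, (tagged p).2) | p <- splits s]
  end.

(* [f x e] is the component in (Sigma a(A_0, A_n))^e of the value of [f] at the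
   string x.  A map of degree d takes x to degree [sdeg x + d]; keeping the
   output degree [e] as an argument, and asking in [homogeneous] that all
   components with [e != sdeg x + d] vanish, avoids transporting elements along
   equalities between degrees.  By the universal property of the tensor product,
   multilinear maps on strings are linear maps on the tensor products. *)
Definition cochain :=
  forall A B : a, str a A B -> forall e : int, susp (qhom a A B) e.

Definition multilinear (f : cochain) : Prop :=
  forall (A B C D : a) (i : int) (u : str a C D) (c : k)
    (x y : susp (qhom a B C) i) (v : str a A B) (e : int),
  f A D (scat u (scons (c *: x + y) v)) e =
  c *: f A D (scat u (scons x v)) e + f A D (scat u (scons y v)) e.

Definition homogeneous (d : int) (f : cochain) : Prop :=
  forall (A B : a) (x : str a A B) (e : int), e != sdeg x + d -> f A B x e = 0.

Definition C_br (d : int) : set cochain :=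
  [set f | multilinear f /\ homogeneous d f].

(* C(a) = Sigma^-1 C_br(a) *)
Definition Hoch (n : int) : set cochain := C_br (n - 1).

Definition cochain_add (f g : cochain) : cochain := fun A B x e => f A B x e + g A B x e.
Definition cochain_scale (c : k) (f : cochain) : cochain := fun A B x e => c *: f A B x e.
Definition cochain0 : cochain := fun A B x e => 0.

Definition ksign (n : int) : k := (-1) ^+ `|n|%N.

Definition total_degree (L : seq (int * cochain)) : int := \sum_(p <- L) p.1.

(* A list [L] = [:: (d_1, f_1); ...; (d_m, f_m)] stands for the cochains f_j of
   C_br-degree d_j.  [insertions L x] lists the terms of
     sum (1 (x) ... (x) f_1 (x) 1 ... (x) f_m (x) ... (x) 1) (x),
   each as a pair of a Koszul sign and a string.  If x = w (x) u (x) v and f_1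
   is applied to u, then f_1 moves past w, whereas f_2, ..., f_m move past both
   w and u, as well as past the part of v which is accounted for by the
   recursive call. *)
Fixpoint insertions (L : seq (int * cochain)) (A C : a) (x : str a A C) :
    seq (k * str a A C) :=
  match L with
  | [::] => [:: (1, x)]
  | (d, f) :: L' =>
      flatten [seq let w := (tagged p).1 in
        flatten [seq let u := (tagged q).1 in let v := (tagged q).2 in
          [seq (ksign (d * sdeg w + total_degree L' * (sdeg w + sdeg u)) * y.1,
                scat w (scons (f _ _ u (sdeg u + d)) y.2))
          | y <- insertions L' v]
        | q <- splits (tagged p).2]
      | p <- splits x]
  end.

Definition brace (f : cochain) (L : seq (int * cochain)) : cochain :=
  fun A B x e => \sum_(y <- insertions L x) y.1 *: f A B y.2 e.

(* The bracket of f and g, of C_br-degrees d and d'. *)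
Definition bracket (d : int) (f : cochain) (d' : int) (g : cochain) : cochain :=
  fun A B x e =>
    brace f [:: (d', g)] x e - ksign (d * d') *: brace g [:: (d, f)] x e.

(* d_Hoch = [mu, -] on C^n(a), for mu in C^2(a). *)
Definition dHoch (mu : cochain) (n : int) (f : cochain) : cochain :=
  bracket 1 mu (n - 1) f.

Definition Hoch_cocycle (mu : cochain) (n : int) (f : cochain) : Prop :=
  Hoch n f /\ dHoch mu n f = cochain0.

Definition cAinf_structure (mu : cochain) : Prop :=
  Hoch 2 mu /\ brace mu [:: (1, mu)] = cochain0.

(* The embrace by an element psi of C^1(a)_0, hence of C_br-degree 0.  The sum
   over all m >= 0 is taken pointwise; it is meaningful when its support is
   finite at each string, which is what [embraceable] says (a sum with infinite
   support is 0 by convention). *)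
Definition embr_term (psi nu : cochain) (m : nat) : cochain :=
  brace nu (nseq m (0, psi)).

Definition embraceable (psi nu : cochain) : Prop :=
  forall (A B : a) (x : str a A B) (e : int),
  finite_set [set m : nat | embr_term psi nu m x e != 0].

Definition embr (psi nu : cochain) : cochain :=
  fun A B x e => \sum_(m \in [set: nat]) embr_term psi nu m x e.

End Cochains.
Arguments cochain {k} a.
Arguments cochain0 {k a}.
Arguments C_br {k} a d.
Arguments Hoch {k} a n.

(* Extending a quiver and its cochains along a map of objects: a_Psi is the
   pullback along (A, psi_A) |-> A, and relabelling is the pullback along a
   bijection. *)
Section Pullback.
Variables (k : comPzRingType) (a : quiver k) (O : Type) (p : O -> a).

Definition pull_quiver : quiver k :=
  @Quiver k O (fun P Q => qhom a (p P) (p Q)).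

Fixpoint push_str (P Q : pull_quiver) (x : str pull_quiver P Q) :
    str a (p P) (p Q) :=
  match x in str _ P Q return str a (p P) (p Q) with
  | snil P => snil (p P)
  | scons P Q R i h s => @scons k a (p P) (p Q) (p R) i h (push_str s)
  end.

Definition pull_cochain (f : cochain a) : cochain pull_quiver :=
  fun P Q x e => f (p P) (p Q) (push_str x) e.

End Pullback.
Arguments pull_cochain {k a O} p f.

Section PsiQuiver.
Variables (k : comPzRingType) (a : quiver k).
Variable Psi : forall A : a, set (qhom a A A 1).

Definition psi_ob : Type := {A : a & {x : qhom a A A 1 | Psi x}}.
Definition psi_base (P : psi_ob) : a := projT1 P.
Definition psi_elt (P : psi_ob) : qhom a (psi_base P) (psi_base P) 1 :=
  proj1_sig (projT2 P).

Definition psi_quiver : quiver k := pull_quiver psi_base.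

Definition psi_extend (f : cochain a) : cochain psi_quiver :=
  pull_cochain psi_base f.

(* The element psi of C^1(a_Psi)_0: it vanishes on nonempty strings, and its
   value on the empty string at (A, psi_A) is psi_A in (Sigma a(A, A))^0. *)
Definition tautological : cochain psi_quiver :=
  fun P Q x =>
  match x in str _ P Q return forall e, susp (qhom psi_quiver P Q) e with
  | snil P => fun e =>
      match e return susp (qhom psi_quiver P P) e with
      | Posz 0 => psi_elt P
      | _ => 0
      end
  | scons _ _ _ _ _ _ => fun e => 0
  end.

End PsiQuiver.

Section Deformation.
Variables (k : comPzRingType) (a : quiver k).

Definition dual_quiver : quiver (dual k) :=
  @Quiver (dual k) a (fun A B i => dual (qhom a A B i) : lmodType (dual k)).

Fixpoint re_str (A B : dual_quiver) (x : str dual_quiver A B) : str a A B :=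
  match x in str _ A B return str a A B with
  | snil A => snil (a := a) A
  | scons A B C i h s => @scons k a A B C i (re h) (re_str s)
  end.

(* The coefficient of eps in (x_n + y_n eps) (x) ... (x) (x_1 + y_1 eps), as the
   list of its summands x_n (x) ... (x) y_i (x) ... (x) x_1. *)
Fixpoint ep_str (A B : dual_quiver) (x : str dual_quiver A B) :
    seq (str a A B) :=
  match x in str _ A B return seq (str a A B) with
  | snil A => [::]
  | scons A B C i h s => @scons k a A B C i (ep h) (re_str s) ::
      [seq @scons k a A B C i (re h) t | t <- ep_str s]
  end.

(* The k[eps]-multilinear extension of a cochain. *)
Definition dual_extend (f : cochain a) : cochain dual_quiver :=
  fun A B x e =>
    Dual (f A B (re_str x) e) (\sum_(y <- ep_str x) f A B y e).

Definition deformed_structure (mu phi : cochain a) : cochain dual_quiver :=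
  cochain_add (dual_extend mu) (cochain_scale (epsilon k) (dual_extend phi)).

End Deformation.

(* A quiver with a cochain; it is a cA_infinity-category when [is_cAinf]
   holds. *)
Record structured_quiver (k : comPzRingType) := StructuredQuiver {
  carrier :> quiver k;
  structure : cochain carrier }.
Arguments structure {k} s.

Definition is_cAinf (k : comPzRingType) (X : structured_quiver k) : Prop :=
  cAinf_structure (structure X).

Definition relabel (k : comPzRingType) (X : structured_quiver k)
    (O : Type) (p : O -> X) : structured_quiver k :=
  StructuredQuiver (pull_cochain p (structure X)).

Definition linear_deformation (k : comPzRingType) (a : quiver k)
    (mu phi : cochain a) : structured_quiver (dual k) :=
  StructuredQuiver (deformed_structure mu phi).

Section TotalAndTwisted.
Variables (k : comPzRingType) (a : quiver k) (mu phi : cochain a).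

Definition all_psi (A : a) : set (qhom a A A 1) := setT.
Arguments all_psi A _ : clear implicits.

Definition total_cocycle : cochain (psi_quiver all_psi) :=
  cochain_add (psi_extend phi)
    (brace (psi_extend mu) [:: (0, tautological (Psi := all_psi))]).

Definition total_deformation : structured_quiver (dual k) :=
  linear_deformation (psi_extend (Psi := all_psi) mu) total_cocycle.

Definition all_psi_eps (A : dual_quiver a) : set (qhom (dual_quiver a) A A 1) :=
  @times_eps (qhom a A A 1) @` all_psi A.
Arguments all_psi_eps A _ : clear implicits.

Definition psi_eps : cochain (psi_quiver all_psi_eps) :=
  @tautological _ _ all_psi_eps.

Definition extended_deformation : cochain (psi_quiver all_psi_eps) :=
  psi_extend (deformed_structure mu phi).

Definition twisted_deformation : structured_quiver (dual k) :=
  StructuredQuiver (embr psi_eps extended_deformation).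

(* (A, psi_A) |-> (A, psi_A eps) *)
Definition identification (P : total_deformation) : twisted_deformation :=
  let base : a := psi_base (P : psi_ob all_psi) in
  existT (fun A : a => {y : dual (qhom a A A 1) | all_psi_eps A y}) base
    (exist (all_psi_eps base) (times_eps (psi_elt (P : psi_ob all_psi)))
       (imageP (@times_eps _) (proj2_sig (projT2 P)))).

End TotalAndTwisted.

(* Main.v *)
From HB Require Import structures.
Require Import Defs.
From mathcomp Require Import all_boot all_order all_algebra.
From mathcomp Require Import boolp classical_sets cardinality fsbigop.
From mathcomp Require Import zify ring.

Set Implicit Arguments.
Unset Strict Implicit.
Unset Printing Implicit Defensive.

Import GRing.Theory.

Local Open Scope ring_scope.

(** The identification is bijective, and pulling back along it turns the
    tautological element of the twisted side into [eps psi], where [psi] is the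
    tautological element of the total side, and [mu + phi eps] into its trivial
    extension to that side.  It remains to compute the embrace there.  Since
    [nu{_, ..., _}] is multilinear over [k[eps]] when [nu] is, the term of
    order [m] is [eps^m] times an embrace by [psi], so that it vanishes for
    [m >= 2].  Hence the sum is finite, and it equals
      [mu + phi eps + eps mu{psi} = mu + (phi + mu{psi}) eps],
    which is the structure of the total deformation.  The lemmas are
    [embr_first_order], [pull_extended_deformation] and [pull_psi_eps]; that
    braces commute with the extension of scalars from [k] to [k[eps]] is
    [dual_extend_brace].

    That the total deformation is a cA_infinity-category means, by comparing
    coefficients of [1] and [eps] in [(mu + theta eps){mu + theta eps}]
    ([deformation_cAinf]), that [theta = phi + mu{psi}] is a Hochschild cocycle.
    For [mu{psi}] this is [mu{mu{psi}} + mu{psi}{mu} = 0]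
    ([zero_part_coboundary]).  It follows from the pre-Lie identity
      [f{g}{h} = f{g, h} + f{g{h}} + (-1)^(|g||h|) f{h, g}]
    ([pre_Lie]), applied to [mu{psi}{mu}] and to [mu{mu}{psi} = 0], because
    [psi{mu} = 0] for an element [psi] of the zero part.

    The cA_infinity-axioms of the twisted category are then transported back
    along the identification: a map of object sets which is onto lifts every
    composable string, so that equations between cochains may be checked after
    pulling back ([str_lifted], [cAinf_of_pull]). *)

(** * Signs, strings and sums over factorizations of a string *)

Lemma cochain_ext (k : comPzRingType) (a : quiver k) (f g : cochain a) :
  (forall A B (x : str a A B) e, f A B x e = g A B x e) -> f = g.
Proof.
move=> fg; apply: functional_extensionality_dep => A.
apply: functional_extensionality_dep => B.
apply: functional_extensionality_dep => x.
by apply: functional_extensionality_dep => e; exact: fg.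
Qed.

Lemma ksignD (k : comPzRingType) (m n : int) :
  ksign k (m + n) = ksign k m * ksign k n.
Proof.
rewrite /ksign -exprD -[LHS]signr_odd -[RHS]signr_odd; congr (_ ^+ _).
by lia.
Qed.

Section Strings.
Variables (k : comPzRingType) (a : quiver k).

Lemma scatA (A B C D : a) (x : str a C D) (y : str a B C) (z : str a A B) :
  scat (scat x y) z = scat x (scat y z).
Proof. by elim: x y => //= ? ? ? ? h s IH y; rewrite IH. Qed.

Lemma sdeg_cat (A B C : a) (x : str a B C) (y : str a A B) :
  sdeg (scat x y) = sdeg x + sdeg y.
Proof.
elim: x y => [?|? ? ? ? h s IH] y /=; first by rewrite add0r.
by rewrite IH addrA.
Qed.

Section CutSum.
Variable V : zmodType.

(** The Sweedler sum [F (x_(1), x_(2))] for the deconcatenation coproduct. *)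
Definition cutsum (A C : a) (x : str a A C)
    (F : forall B, str a B C -> str a A B -> V) : V :=
  \sum_(p <- splits x) F (tag p) (tagged p).1 (tagged p).2.

Lemma cutsum_nil (A : a) F : cutsum (snil A) F = F A (snil A) (snil A).
Proof. by rewrite /cutsum big_seq1. Qed.

Lemma cutsum_cons (A B C : a) i (h : susp (qhom a B C) i) (s : str a A B) F :
  cutsum (scons h s) F =
  F C (snil C) (scons h s) + cutsum s (fun D u v => F D (scons h u) v).
Proof. by rewrite /cutsum /= big_cons big_map. Qed.

(** The equation [scat w r = x] is available in the summands; it is what allows
    Koszul signs, which depend on degrees, to be compared. *)
Lemma eq_cutsum (A C : a) (x : str a A C) F G :
  (forall B (w : str a B C) r, scat w r = x -> F B w r = G B w r) ->
  cutsum x F = cutsum x G.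
Proof.
elim: x F G => [A'|A' B C' i h s IH] F G FG.
  by rewrite !cutsum_nil FG.
rewrite !cutsum_cons FG //; congr (_ + _).
by apply: IH => D w r E; apply: FG => /=; rewrite E.
Qed.

Lemma cutsumD (A C : a) (x : str a A C) F G :
  cutsum x (fun B w r => F B w r + G B w r) = cutsum x F + cutsum x G.
Proof. exact: big_split. Qed.

Lemma cutsum0 (A C : a) (x : str a A C) : cutsum x (fun _ _ _ => 0) = 0.
Proof. exact: big1. Qed.

(** Coassociativity of deconcatenation: both sides sum over the factorizations
    of [x] into three strings. *)
Lemma cutsum_coassoc (A D : a) (x : str a A D)
    (F : forall B C, str a C D -> str a B C -> str a A B -> V) :
  cutsum x (fun B y v => cutsum y (fun C w u => F B C w u v)) =
  cutsum x (fun C w y => cutsum y (fun B u v => F B C w u v)).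
Proof.
elim: x F => [A'|A' B C i h s IH] F; first by rewrite !cutsum_nil.
rewrite 2!cutsum_cons cutsum_nil cutsum_cons -addrA; congr (_ + _).
rewrite -IH -cutsumD; apply: eq_cutsum => E w r _.
by rewrite cutsum_cons.
Qed.

(** A cut of [w (x) h (x) v] lies either to the left or to the right of [h]. *)
Lemma cutsum_cat_cons (A B C D : a) i (w : str a C D)
    (h : susp (qhom a B C) i) (v : str a A B) F :
  cutsum (scat w (scons h v)) F =
  cutsum w (fun E w1 w2 => F E w1 (scat w2 (scons h v))) +
  cutsum v (fun E v1 v2 => F E (scat w (scons h v1)) v2).
Proof.
elim: w h F => [C'|C' E D' j h' s IH] h F /=.
  by rewrite cutsum_nil cutsum_cons.
by rewrite !cutsum_cons IH addrA.
Qed.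

(** The middle one of three consecutive pieces lies to the right of [h] in the
    last sum, to its left in the first one, and contains it in the second one.
    This trichotomy is the source of the three terms of [pre_Lie]. *)
Lemma cutsum_triple_cat_cons (A B C D : a) i (w : str a C D)
    (h : susp (qhom a B C) i) (v : str a A B)
    (F : forall E E', str a E D -> str a E' E -> str a A E' -> V) :
  cutsum (scat w (scons h v)) (fun E w' r =>
    cutsum r (fun E' u c => F E E' w' u c)) =
  cutsum w (fun E w' r =>
    cutsum r (fun E' u c => F E E' w' u (scat c (scons h v)))) +
  cutsum w (fun E w' b =>
    cutsum v (fun E' c d => F E E' w' (scat b (scons h c)) d)) +
  cutsum v (fun E b r =>
    cutsum r (fun E' u c => F E E' (scat w (scons h b)) u c)).
Proof.
rewrite cutsum_cat_cons; congr (_ + _); rewrite -cutsumD.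
by apply: eq_cutsum => E w' r _; rewrite cutsum_cat_cons.
Qed.

Lemma cutsum_exchange (A C B D : a) (x : str a A C) (y : str a B D)
    (F : forall E E', str a E C -> str a A E -> str a E' D -> str a B E' -> V) :
  cutsum x (fun E w r => cutsum y (fun E' u v => F E E' w r u v)) =
  cutsum y (fun E' u v => cutsum x (fun E w r => F E E' w r u v)).
Proof. exact: exchange_big. Qed.

End CutSum.

Lemma cutsumZ (V : lmodType k) c (A C : a) (x : str a A C)
    (F : forall B, str a B C -> str a A B -> V) :
  c *: cutsum x F = cutsum x (fun B w r => c *: F B w r).
Proof. exact: scaler_sumr. Qed.

Lemma linear_cutsum (V W : lmodType k) (l : {linear V -> W}) (A C : a)
    (x : str a A C) (F : forall B, str a B C -> str a A B -> V) :
  l (cutsum x F) = cutsum x (fun B w r => l (F B w r)).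
Proof. exact: linear_sum. Qed.

End Strings.

(** * Braces and the pre-Lie identity *)

Section Braces.
Variables (k : comPzRingType) (a : quiver k).

(** Multilinearity for a function of strings with fixed endpoints.  Unlike
    [multilinear], it applies to [z |-> f (w (x) z)], hence can be carried
    through the recursion that defines [insertions]. *)
Definition slotlin (V : lmodType k) (A D : a) (G : str a A D -> V) : Prop :=
  forall (B C : a) (i : int) (u : str a C D) (c : k)
    (x y : susp (qhom a B C) i) (v : str a A B),
  G (scat u (scons (c *: x + y) v)) =
  c *: G (scat u (scons x v)) + G (scat u (scons y v)).

Lemma multilinearE (f : cochain a) :
  multilinear f <-> forall A B e, slotlin (fun x => f A B x e).
Proof. by split=> fl => [A B e|A B]; move=> *; exact: fl. Qed.

(** The restriction to one slot, packed as a linear map in order to commute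
    with sums and scalars. *)
Lemma slotlin_map (V : lmodType k) (A D : a) (G : str a A D -> V) :
  slotlin G -> forall (B C : a) i (u : str a C D) (v : str a A B),
  exists L : {linear susp (qhom a B C) i -> V},
    forall x, G (scat u (scons x v)) = L x.
Proof.
move=> Gl B C i u v; pose L (x : susp (qhom a B C) i) := G (scat u (scons x v)).
have Ll : linear L by move=> c x y; exact: Gl.
pose LL := GRing.isLinear.Build k (susp (qhom a B C) i) V *:%R L Ll.
pose l : {linear susp (qhom a B C) i -> V} := HB.pack L LL.
by exists l.
Qed.

Lemma slotlin_cat (V : lmodType k) (A D E : a) (G : str a A E -> V)
    (w : str a D E) : slotlin G -> slotlin (fun z : str a A D => G (scat w z)).
Proof. by move=> Gl B C i u c x y v; rewrite -!scatA Gl. Qed.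

Lemma slotlin_cons (V : lmodType k) (A D E : a) j (h : susp (qhom a D E) j)
    (G : str a A E -> V) :
  slotlin G -> slotlin (fun z : str a A D => G (scons h z)).
Proof. by move=> Gl B C i u c x y v; exact: (Gl B C i (scons h u)). Qed.

(** Of the components of [g] at [u], the one in degree [sdeg u + d] is the only
    one that can be nonzero when [g] has degree [d]; hence this string stands for
    [g(u) (x) v]. *)
Definition place (d : int) (g : cochain a) (A B C : a)
    (u : str a B C) (v : str a A B) : str a A C :=
  scons (g _ _ u (sdeg u + d)) v.

(** The degree [e] indexes the type of [g _ _ u e], so that equal degrees are
    exchanged here rather than by transport. *)
Lemma placeE d g A B C (u : str a B C) (v : str a A B) e :
  e = sdeg u + d -> scons (g _ _ u e) v = place d g u v.
Proof. by move=> ->. Qed.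

(** Strings are not elements of a module, so an identity in the tensor coalgebra
    is expressed by applying to both sides a test function [G] of strings.  Every
    brace is the case where [G] is a component of a cochain ([braceE]). *)
Definition inssum (V : lmodType k) L (A C : a) (x : str a A C)
  (G : str a A C -> V) : V := \sum_(y <- insertions L x) y.1 *: G y.2.

Lemma inssum_nil (V : lmodType k) (A C : a) (x : str a A C)
    (G : str a A C -> V) :
  inssum [::] x G = G x.
Proof. by rewrite /inssum big_seq1 scale1r. Qed.

Lemma inssum_cons (V : lmodType k) d g L (A C : a) (x : str a A C)
    (G : str a A C -> V) :
  inssum ((d, g) :: L) x G =
  cutsum x (fun D w r => cutsum r (fun B u v =>
    ksign k (d * sdeg w + total_degree L * (sdeg w + sdeg u)) *:
      inssum L v (fun z => G (scat w (place d g u z))))).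
Proof.
rewrite /inssum /= big_flatten big_map; apply: eq_bigr => p _.
rewrite big_flatten big_map; apply: eq_bigr => q _.
by rewrite big_map scaler_sumr; apply: eq_bigr => y _; rewrite scalerA.
Qed.

Lemma inssum1 (V : lmodType k) d g (A C : a) (x : str a A C)
    (G : str a A C -> V) :
  inssum [:: (d, g)] x G =
  cutsum x (fun D w r => cutsum r (fun B u v =>
    ksign k (d * sdeg w) *: G (scat w (place d g u v)))).
Proof.
rewrite inssum_cons; apply: eq_cutsum => D w r _; apply: eq_cutsum => B u v _.
by rewrite inssum_nil /total_degree big_nil mul0r addr0.
Qed.

Lemma inssum2 (V : lmodType k) d g d' h (A C : a) (x : str a A C)
    (G : str a A C -> V) :
  inssum [:: (d, g); (d', h)] x G =
  cutsum x (fun D w r => cutsum r (fun B u v =>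
  cutsum v (fun E c z => cutsum z (fun F u' v' =>
    ksign k (d * sdeg w + d' * (sdeg w + sdeg u + sdeg c)) *:
      G (scat w (place d g u (scat c (place d' h u' v')))))))).
Proof.
rewrite inssum_cons; apply: eq_cutsum => D w r _; apply: eq_cutsum => B u v _.
rewrite inssum1 cutsumZ; apply: eq_cutsum => E c z _; rewrite cutsumZ.
apply: eq_cutsum => F u' v' _.
rewrite /total_degree big_seq1 scalerA -ksignD; congr (ksign k _ *: _).
by ring.
Qed.

Lemma eq_inssum (V : lmodType k) L (A C : a) (x : str a A C)
    (G H : str a A C -> V) :
  (forall y, G y = H y) -> inssum L x G = inssum L x H.
Proof. by move=> GH; apply: eq_bigr => y _; rewrite GH. Qed.

Lemma inssumD (V : lmodType k) L (A C : a) (x : str a A C)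
    (G H : str a A C -> V) :
  inssum L x (fun y => G y + H y) = inssum L x G + inssum L x H.
Proof. by rewrite -big_split; apply: eq_bigr => y _; rewrite scalerDr. Qed.

Lemma inssumZ (V : lmodType k) L c (A C : a) (x : str a A C)
    (G : str a A C -> V) :
  inssum L x (fun y => c *: G y) = c *: inssum L x G.
Proof.
rewrite scaler_sumr; apply: eq_bigr => y _.
by rewrite !scalerA mulrC.
Qed.

Lemma inssum_scale_head (V : lmodType k) d c g L (A C : a) (x : str a A C)
    (G : str a A C -> V) : slotlin G ->
  inssum ((d, cochain_scale c g) :: L) x G = c *: inssum ((d, g) :: L) x G.
Proof.
move=> Gl; rewrite !inssum_cons cutsumZ; apply: eq_cutsum => D w r _.
rewrite cutsumZ; apply: eq_cutsum => B u v _.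
rewrite scalerA [c * _]mulrC -scalerA -inssumZ.
congr (_ *: _); apply: eq_inssum => z.
have [l lE] := slotlin_map Gl (sdeg u + d) w z.
by rewrite /place /cochain_scale !lE linearZ.
Qed.

Lemma inssum_add_head (V : lmodType k) d g g' L (A C : a) (x : str a A C)
    (G : str a A C -> V) : slotlin G ->
  inssum ((d, cochain_add g g') :: L) x G =
  inssum ((d, g) :: L) x G + inssum ((d, g') :: L) x G.
Proof.
move=> Gl; rewrite !inssum_cons -cutsumD; apply: eq_cutsum => D w r _.
rewrite -cutsumD; apply: eq_cutsum => B u v _; rewrite -scalerDr -inssumD.
congr (_ *: _); apply: eq_inssum => z.
have [l lE] := slotlin_map Gl (sdeg u + d) w z.
by rewrite /place /cochain_add !lE linearD.
Qed.

Lemma slotlin_place (V : lmodType k) (A D C : a) (G : str a A C -> V)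
   d g B (w : str a D C) (u : str a B D) : slotlin G ->
  slotlin (fun z => G (scat w (place d g u z))).
Proof. by move=> Gl; exact: (slotlin_cons _ (slotlin_cat w Gl)). Qed.

Lemma braceE f L (A B : a) (x : str a A B) e :
  brace f L x e = inssum L x (fun y => f A B y e).
Proof. by []. Qed.

Lemma brace_addl (f f' : cochain a) L :
  brace (cochain_add f f') L = cochain_add (brace f L) (brace f' L).
Proof. by apply: cochain_ext => A B x e; rewrite !braceE inssumD. Qed.

Lemma brace_scalel c (f : cochain a) L :
  brace (cochain_scale c f) L = cochain_scale c (brace f L).
Proof. by apply: cochain_ext => A B x e; rewrite !braceE inssumZ. Qed.

Lemma brace_nil (f : cochain a) : brace f [::] = f.
Proof. by apply: cochain_ext => A B x e; rewrite braceE inssum_nil. Qed.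

Lemma brace_scaler d c (f g : cochain a) L : multilinear f ->
  brace f ((d, cochain_scale c g) :: L) =
  cochain_scale c (brace f ((d, g) :: L)).
Proof.
move=> /multilinearE fl; apply: cochain_ext => A B x e.
by rewrite !braceE inssum_scale_head.
Qed.

Lemma brace_addr d (f g g' : cochain a) L : multilinear f ->
  brace f ((d, cochain_add g g') :: L) =
  cochain_add (brace f ((d, g) :: L)) (brace f ((d, g') :: L)).
Proof.
move=> /multilinearE fl; apply: cochain_ext => A B x e.
by rewrite !braceE inssum_add_head.
Qed.

(** Two entries divisible by [c] contribute [c^2]; for [c = eps] this makes the
    terms of order at least 2 of the embrace vanish. *)
Lemma brace_scale2 d d' c (f g g' : cochain a) L : multilinear f ->
  brace f [:: (d, cochain_scale c g), (d', cochain_scale c g') & L] =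
  cochain_scale (c * c) (brace f [:: (d, g), (d', g') & L]).
Proof.
move=> fl; rewrite brace_scaler //; apply: cochain_ext => A B x e.
move/multilinearE: fl => fl.
rewrite /cochain_scale -scalerA; congr (_ *: _); rewrite !braceE.
rewrite !inssum_cons cutsumZ; apply: eq_cutsum => D w r _; rewrite cutsumZ.
apply: eq_cutsum => E u v _; rewrite inssum_scale_head;
  last exact: (slotlin_place d g w u (fl A B e)).
rewrite !scalerA [c * _]mulrC; congr (ksign _ _ * _ *: _).
by rewrite /total_degree !big_cons.
Qed.

(** When [g] is inserted into the result of inserting [h] into [x], it is applied
    to a piece on the left of the new factor [h(u)], to a piece that contains it,
    or to a piece on its right.  In the last case [g] moves past [h(u)] instead
    of past [u], which costs the sign [(-1)^(d d')]. *)
Lemma pre_Lie d d' (f g h : cochain a) : multilinear f ->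
  brace (brace f [:: (d, g)]) [:: (d', h)] =
  cochain_add (brace f [:: (d, g); (d', h)])
 (cochain_add (brace f [:: (d + d', brace g [:: (d', h)])])
    (cochain_scale (ksign k (d * d')) (brace f [:: (d', h); (d, g)]))).
Proof.
move=> /multilinearE fl; apply: cochain_ext => A B x e.
rewrite /cochain_add /cochain_scale !braceE inssum1 !inssum2.
transitivity (cutsum x (fun D w r => cutsum r (fun E u v =>
  cutsum w (fun F w' s => cutsum s (fun F' u' c =>
    ksign k (d' * sdeg w + d * sdeg w') *:
     f A B (scat w' (place d g u' (scat c (place d' h u v)))) e))))
 + (cutsum x (fun D w r => cutsum r (fun E u v =>
   cutsum w (fun F w' b => cutsum v (fun F' c z =>
    ksign k (d' * sdeg w + d * sdeg w') *:
     f A B (scat w' (place d g (scat b (place d' h u c)) z)) e)))) +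
  cutsum x (fun D w r => cutsum r (fun E u v =>
   cutsum v (fun F b s => cutsum s (fun F' u' c =>
    ksign k (d' * sdeg w + d * (sdeg w + (sdeg u + d' + sdeg b))) *:
     f A B (scat w (place d' h u (scat b (place d g u' c)))) e)))))).
  rewrite -!cutsumD; apply: eq_cutsum => D w r _.
  rewrite -!cutsumD; apply: eq_cutsum => E u v _.
  rewrite braceE inssum1 cutsum_triple_cat_cons -addrA !scalerDr.
  congr (_ + (_ + _));
    rewrite cutsumZ; apply: eq_cutsum => F w' s _; rewrite cutsumZ;
    apply: eq_cutsum => F' c z _; rewrite scalerA -ksignD //.
  by rewrite sdeg_cat /= scatA.
congr (_ + (_ + _)).
(* Here x = w' u' c u v, cut at u first on one side and at u' first on the
   other. *)
- pose X B1 B2 B3 B4 (w' : str a B1 B) (u' : str a B2 B1) (c : str a B3 B2)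
      (u : str a B4 B3) (v : str a A B4) :=
    ksign k (d * sdeg w' + d' * (sdeg w' + sdeg u' + sdeg c)) *:
    f A B (scat w' (place d g u' (scat c (place d' h u v)))) e.
  transitivity (cutsum x (fun D w r => cutsum w (fun F w' s =>
    cutsum s (fun F' u' c => cutsum r (fun E u v => X F F' D E w' u' c u v))))).
    apply: eq_cutsum => D w r _; rewrite cutsum_exchange.
    apply: eq_cutsum => F w' s Ew; rewrite cutsum_exchange.
    apply: eq_cutsum => F' u' c Es; apply: eq_cutsum => E u v _.
    rewrite /X -Ew -Es !sdeg_cat; congr (ksign k _ *: _).
    by ring.
  rewrite cutsum_coassoc; apply: eq_cutsum => F w' y _.
  by rewrite cutsum_coassoc.
(* Here x = w' b u c z, where g is applied to b h(u) c. *)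
- pose X B1 B2 B3 B4 (w' : str a B1 B) (b : str a B2 B1) (u : str a B3 B2)
      (c : str a B4 B3) (z : str a A B4) :=
    ksign k (d' * (sdeg w' + sdeg b) + d * sdeg w') *:
    f A B (scat w' (place d g (scat b (place d' h u c)) z)) e.
  transitivity (cutsum x (fun D w r => cutsum w (fun F w' b =>
    cutsum r (fun E u v => cutsum v (fun F' c z => X F D E F' w' b u c z))))).
    apply: eq_cutsum => D w r _; rewrite cutsum_exchange.
    apply: eq_cutsum => F w' b Ew; apply: eq_cutsum => E u v _.
    by apply: eq_cutsum => F' c z _; rewrite /X -Ew sdeg_cat.
  rewrite inssum1 cutsum_coassoc; apply: eq_cutsum => F w' r' _.
  transitivity (cutsum r' (fun D y z => cutsum y (fun E b s =>
    cutsum s (fun F' u c => X F E F' D w' b u c z)))).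
    rewrite cutsum_coassoc; apply: eq_cutsum => E b t _.
    by rewrite cutsum_coassoc.
  apply: eq_cutsum => D y z _.
  have [l lE] := slotlin_map (fl A B e) (sdeg y + (d + d')) w' z.
  rewrite /place lE braceE inssum1 linear_cutsum cutsumZ.
  apply: eq_cutsum => E b s Ey.
  rewrite linear_cutsum cutsumZ; apply: eq_cutsum => F' u c Es.
  rewrite linearZ scalerA -lE -ksignD /X (placeE (d := d)); last first.
    by rewrite -Ey -Es !sdeg_cat /=; ring.
  congr (ksign k _ *: _).
  by ring.
- rewrite cutsumZ; apply: eq_cutsum => D w r _.
  rewrite cutsumZ; apply: eq_cutsum => E u v _.
  rewrite cutsumZ; apply: eq_cutsum => F b s _.
  rewrite cutsumZ; apply: eq_cutsum => F' u' c _.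
  rewrite scalerA -ksignD; congr (ksign k _ *: _).
  by ring.
Qed.

End Braces.

(** * Multilinearity and degree of a brace *)

Section BraceClosure.
Variables (k : comPzRingType) (a : quiver k).

Lemma cutsum_lin (V : lmodType k) (A C : a) (x : str a A C) (c : k)
    (F G H : forall B, str a B C -> str a A B -> V) :
  (forall B (w : str a B C) r, F B w r = c *: G B w r + H B w r) ->
  cutsum x F = c *: cutsum x G + cutsum x H.
Proof.
by move=> FGH; rewrite cutsumZ -cutsumD; apply: eq_cutsum => B w r _.
Qed.

Lemma scale_lin (V : lmodType k) (s c : k) (x y z : V) :
  x = c *: y + z -> s *: x = c *: (s *: y) + s *: z.
Proof. by move=> ->; rewrite scalerDr !scalerA mulrC. Qed.

(** The slot in question lies to the right of, inside, or to the left of the piece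
    to which [g] is applied. *)
Lemma inssum1_slotlin (V : lmodType k) d (g : cochain a) (A D : a)
    (G : str a A D -> V) :
  multilinear g -> slotlin G -> slotlin (fun x => inssum [:: (d, g)] x G).
Proof.
move=> gl Gl B C i w c x y v; rewrite !inssum1 !cutsum_triple_cat_cons.
rewrite !scalerDr addrACA [X in _ = X + _]addrACA.
congr (_ + _ + _); apply: cutsum_lin => E w' r; apply: cutsum_lin => E' u z.
- by apply: scale_lin; exact: (slotlin_place d g w' u Gl).
- apply: scale_lin.
  have [l lE] := slotlin_map Gl (sdeg r + (i + sdeg u) + d) w' z.
  have slot (h : susp (qhom a B C) i) :
      G (scat w' (place d g (scat r (scons h u)) z)) =
      l (g _ _ (scat r (scons h u)) (sdeg r + (i + sdeg u) + d)).
    by rewrite -lE (@placeE _ _ d) // sdeg_cat.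
  by rewrite !slot gl linearP.
- rewrite !sdeg_cat /=; apply: scale_lin.
  by rewrite !scatA; exact: Gl.
Qed.

Lemma brace1_multilinear d (f g : cochain a) :
  multilinear f -> multilinear g -> multilinear (brace f [:: (d, g)]).
Proof.
move=> /multilinearE fl gl; apply/multilinearE => A B e.
exact: (inssum1_slotlin d gl (fl A B e)).
Qed.

Lemma brace1_homogeneous d d' (f g : cochain a) :
  homogeneous d f -> homogeneous (d + d') (brace f [:: (d', g)]).
Proof.
move=> fh A B x e xe; rewrite braceE inssum1.
rewrite -[RHS](cutsum0 _ x); apply: eq_cutsum => C w r Ex.
rewrite -[RHS](cutsum0 _ r); apply: eq_cutsum => D u v Er.
rewrite fh ?scaler0 //; apply: contra xe => /eqP ->; apply/eqP.
by rewrite -Ex -Er !sdeg_cat /=; ring.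
Qed.

Lemma add_multilinear (f g : cochain a) :
  multilinear f -> multilinear g -> multilinear (cochain_add f g).
Proof.
move=> fl gl A B C D i u c x y v e.
by rewrite /cochain_add fl gl scalerDr addrACA.
Qed.

Lemma add_homogeneous d (f g : cochain a) :
  homogeneous d f -> homogeneous d g -> homogeneous d (cochain_add f g).
Proof.
by move=> fh gh A B x e xe; rewrite /cochain_add fh // gh // addr0.
Qed.

Lemma scale_multilinear c (f : cochain a) :
  multilinear f -> multilinear (cochain_scale c f).
Proof.
move=> fl A B C D i u c' x y v e.
by rewrite /cochain_scale fl scalerDr !scalerA [c * _]mulrC.
Qed.

Lemma scale_homogeneous d c (f : cochain a) :
  homogeneous d f -> homogeneous d (cochain_scale c f).
Proof.
by move=> fh A B x e xe; rewrite /cochain_scale fh // scaler0.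
Qed.

End BraceClosure.

(** * Pulling back along a map of objects *)

Section Pull.
Variables (k : comPzRingType) (a : quiver k) (O : Type) (p : O -> a).
Local Notation b := (pull_quiver p).

Lemma push_scat (P Q R : b) (x : str b Q R) (y : str b P Q) :
  push_str (scat x y) = scat (push_str x) (push_str y).
Proof. by elim: x y => //= ? ? ? ? h s IH y; rewrite IH. Qed.

Lemma push_sdeg (P Q : b) (x : str b P Q) : sdeg (push_str x) = sdeg x.
Proof. by elim: x => //= ? ? ? ? h s ->. Qed.

Lemma cutsum_push (V : zmodType) (P Q : b) (x : str b P Q)
    (F : forall B, str a B (p Q) -> str a (p P) B -> V) :
  cutsum (push_str x) F =
  cutsum x (fun R w r => F (p R) (push_str w) (push_str r)).
Proof.
elim: x F => [P'|P' Q' R i h s IH] F /=; first by rewrite !cutsum_nil.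
by rewrite !cutsum_cons IH.
Qed.

Lemma push_place d (g : cochain a) (P Q R : b) (u : str b Q R) (v : str b P Q) :
  push_str (place d (pull_cochain p g) u v) =
  place d g (push_str u) (push_str v).
Proof.
rewrite -[RHS](@placeE _ _ _ _ _ _ _ _ _ (sdeg u + d)) //.
by rewrite push_sdeg.
Qed.

Lemma inssum_push (V : lmodType k) L (P Q : b) (x : str b P Q)
    (G : str a (p P) (p Q) -> V) :
  inssum L (push_str x) G =
  inssum [seq (q.1, pull_cochain p q.2) | q <- L] x (fun y => G (push_str y)).
Proof.
elim: L Q x G => [|[d g] L IH] Q x G; first by rewrite !inssum_nil.
rewrite /= !inssum_cons cutsum_push; apply: eq_cutsum => D w r _.
rewrite cutsum_push; apply: eq_cutsum => B u v _.
rewrite {2}/total_degree big_map !push_sdeg; congr (_ *: _).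
rewrite IH; apply: eq_inssum => z.
by rewrite push_scat push_place.
Qed.

Lemma pull_brace f L :
  pull_cochain p (brace f L) =
  brace (pull_cochain p f) [seq (q.1, pull_cochain p q.2) | q <- L].
Proof.
by apply: cochain_ext => P Q x e; rewrite /pull_cochain braceE inssum_push.
Qed.

Lemma embr_term_push (P Q : b) psi nu m (x : str b P Q) e :
  embr_term psi nu m (push_str x) e =
  embr_term (pull_cochain p psi) (pull_cochain p nu) m x e.
Proof.
have := congr1 (fun f : cochain b => f P Q x e)
  (pull_brace nu (nseq m (0, psi))).
by rewrite map_nseq.
Qed.

Lemma pull_multilinear f : multilinear f -> multilinear (pull_cochain p f).
Proof.
by move=> fl P Q R S i u c x y v e; rewrite /pull_cochain !push_scat /= fl.
Qed.

Lemma pull_homogeneous d f :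
  homogeneous d f -> homogeneous d (pull_cochain p f).
Proof. by move=> fh P Q x e; rewrite -push_sdeg; exact: fh. Qed.

(** Lifting is stated as an inductive predicate rather than as an equation
    [push_str y = x], which would need a transport along equalities of objects. *)
Variant lifted : forall A B : a, str a A B -> Prop :=
  Lifted P Q (x : str b P Q) : lifted (push_str x).

Hypothesis p_surj : forall A, exists P, p P = A.

Lemma str_lifted (A B : a) (x : str a A B) : lifted x.
Proof.
elim: x => [A'|A' B' C i h s IH].
  by have [P <-] := p_surj A'; exact: (Lifted (snil (a := b) P)).
have [R eR] := p_surj C.
case: C / eR h => h.
case: A' B' s / IH h => P Q x h.
exact: (Lifted (@scons _ b P Q R i h x)).
Qed.

Lemma pull_inj f g : pull_cochain p f = pull_cochain p g -> f = g.
Proof.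
move=> fg; apply: cochain_ext => A B x e; case: A B x / (str_lifted x) => P Q x.
by rewrite -[LHS]/(pull_cochain p f P Q x e) fg.
Qed.

Lemma homogeneous_of_pull d f :
  homogeneous d (pull_cochain p f) -> homogeneous d f.
Proof.
move=> fh A B x e; case: A B x / (str_lifted x) => P Q x.
by rewrite push_sdeg; exact: fh.
Qed.

Lemma multilinear_of_pull f :
  multilinear (pull_cochain p f) -> multilinear f.
Proof.
move=> fl A B C D i u c x y v e.
case: C D u / (str_lifted u) x y => R S u x y.
case: A B v / (str_lifted v) x y => P Q v x y.
have := fl P Q R S i u c x y v e.
by rewrite /pull_cochain !push_scat.
Qed.

Lemma cAinf_of_pull f : cAinf_structure (pull_cochain p f) -> cAinf_structure f.
Proof.
move=> [[fl fh] ff]; split.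
  by split; [exact: multilinear_of_pull | exact: homogeneous_of_pull].
by apply: pull_inj; rewrite pull_brace /= ff.
Qed.

End Pull.

(** * Strings and braces over the dual numbers *)

Section DualStrings.
Variables (k : comPzRingType) (a : quiver k).
Local Notation D := (dual_quiver a).

Lemma re_scat (A B C : D) (x : str D B C) (y : str D A B) :
  re_str (scat x y) = scat (re_str x) (re_str y).
Proof. by elim: x y => //= ? ? ? ? h s IH y; rewrite IH. Qed.

Lemma sdeg_re (A B : D) (x : str D A B) : sdeg (re_str x) = sdeg x.
Proof. by elim: x => //= ? ? ? ? h s ->. Qed.

Lemma cutsum_re (V : zmodType) (A C : D) (x : str D A C)
    (F : forall B, str a B C -> str a A B -> V) :
  cutsum (re_str x) F = cutsum x (fun B w r => F B (re_str w) (re_str r)).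
Proof.
elim: x F => [A'|A' B C' i h s IH] F /=; first by rewrite !cutsum_nil.
by rewrite !cutsum_cons IH.
Qed.

Section EpSum.
Variable V : zmodType.

(** This is the coefficient of [eps] in the value at [x] of the
    [k[eps]]-multilinear extension of [G], when [G] is multilinear. *)
Definition epsum (A C : D) (x : str D A C) (G : str a A C -> V) : V :=
  \sum_(y <- ep_str x) G y.

Lemma epsum_nil (A : D) G : epsum (snil (a := D) A) G = 0.
Proof. exact: big_nil. Qed.

Lemma epsum_cons (A B C : D) i (h : susp (qhom D B C) i) (s : str D A B) G :
  epsum (scons h s) G =
  G (@scons k a A B C i (ep h) (re_str s)) +
  epsum s (fun t => G (@scons k a A B C i (re h) t)).
Proof. by rewrite /epsum /= big_cons big_map. Qed.

Lemma eq_epsum (A C : D) (x : str D A C) (G H : str a A C -> V) :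
  (forall y, sdeg y = sdeg x -> G y = H y) -> epsum x G = epsum x H.
Proof.
elim: x G H => [A'|A' B C' i h s IH] G H GH; first by rewrite !epsum_nil.
rewrite !epsum_cons GH /= ?sdeg_re //; congr (_ + _); apply: IH => y E.
by apply: GH => /=; rewrite E.
Qed.

Lemma epsumD (A C : D) (x : str D A C) (G H : str a A C -> V) :
  epsum x (fun y => G y + H y) = epsum x G + epsum x H.
Proof. exact: big_split. Qed.

Lemma epsum0 (A C : D) (x : str D A C) : epsum x (fun=> 0) = 0.
Proof. exact: big1. Qed.

Lemma epsum_cat (A B C : D) (x : str D B C) (y : str D A B) G :
  epsum (scat x y) G =
  epsum x (fun x' => G (scat x' (re_str y))) +
  epsum y (fun y' => G (scat (re_str x) y')).
Proof.
elim: x y G => [C'|C' E D' j h' s IH] y G /=; first by rewrite epsum_nil add0r.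
by rewrite !epsum_cons re_scat IH addrA.
Qed.

Lemma epsum_cutsum_exchange (A C B E : D) (x : str D A C) (y : str D B E)
    (F : forall B', str a A C -> str D B' E -> str D B B' -> V) :
  epsum x (fun x' => cutsum y (fun B' w r => F B' x' w r)) =
  cutsum y (fun B' w r => epsum x (fun x' => F B' x' w r)).
Proof. exact: exchange_big. Qed.

(** Taking the coefficient of [eps] is a derivation for deconcatenation: the
    factor that is replaced by its coefficient of [eps] lies in one of the two
    pieces. *)
Lemma epsum_cutsum (A C : D) (x : str D A C)
    (F : forall B, str a B C -> str a A B -> V) :
  epsum x (fun y => cutsum y F) =
  cutsum x (fun B w r => epsum w (fun w' => F B w' (re_str r)) +
                       epsum r (fun r' => F B (re_str w) r')).
Proof.
elim: x F => [A'|A' B C' i h s IH] F.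
  by rewrite cutsum_nil !epsum_nil addr0.
rewrite epsum_cons 2!cutsum_cons epsum_nil add0r epsum_cons cutsum_re -!addrA.
congr (_ + _).
under [X in _ + X = _]eq_epsum => t _ do rewrite cutsum_cons.
rewrite epsumD addrCA; congr (_ + _); rewrite IH -cutsumD.
by apply: eq_cutsum => E u v _; rewrite epsum_cons addrA.
Qed.

End EpSum.

Lemma epsumZ (V : lmodType k) c (A C : D) (x : str D A C) (G : str a A C -> V) :
  epsum x (fun y => c *: G y) = c *: epsum x G.
Proof. by rewrite scaler_sumr. Qed.

Lemma linear_epsum (V W : lmodType k) (l : {linear V -> W}) (A C : D)
    (x : str D A C) (G : str a A C -> V) :
  l (epsum x G) = epsum x (fun y => l (G y)).
Proof. exact: linear_sum. Qed.

Lemma ksign_dual n : ksign (dual k) n = Dual (ksign k n) 0.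
Proof.
rewrite /ksign -[LHS]signr_odd -[(-1) ^+ `|n|%N in RHS]signr_odd.
case: odd; rewrite ?expr1 ?expr0 //.
by congr Dual; rewrite oppr0.
Qed.

Lemma dual_eq (T : Type) (u v : dual T) : re u = re v -> ep u = ep v -> u = v.
Proof. by case: u v => x y [x' y'] /= -> ->. Qed.

Lemma re_cutsum (V : zmodType) (A C : D) (x : str D A C)
    (F : forall B, str D B C -> str D A B -> dual V) :
  re (cutsum x F) = cutsum x (fun B w r => re (F B w r)).
Proof. exact: (big_morph (@re V) (fun _ _ => erefl) erefl). Qed.

Lemma ep_cutsum (V : zmodType) (A C : D) (x : str D A C)
    (F : forall B, str D B C -> str D A B -> dual V) :
  ep (cutsum x F) = cutsum x (fun B w r => ep (F B w r)).
Proof. exact: (big_morph (@ep V) (fun _ _ => erefl) erefl). Qed.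

Lemma dual_extend_multilinear (f : cochain a) :
  multilinear f -> multilinear (dual_extend f).
Proof.
move=> /multilinearE fl A B C E i u c x y v e; apply: dual_eq.
  by rewrite /= !re_scat /= fl.
have epE (z : susp (qhom D B C) i) : ep (dual_extend f (scat u (scons z v)) e) =
    epsum u (fun u' => f _ _
      (scat u' (@scons k a A B C i (re z) (re_str v))) e) +
    (f _ _ (scat (re_str u) (@scons k a A B C i (ep z) (re_str v))) e +
     epsum v (fun v' => f _ _
      (scat (re_str u) (@scons k a A B C i (re z) v')) e)).
  by rewrite -[LHS]/(epsum _ _) epsum_cat epsum_cons.
rewrite epE -[RHS]/(_ *: ep _ + _ *: f _ _ (re_str _) e + ep _) !epE.
have epsum_lin (A' C' : D) (w : str D A' C')
    (G H K : str a A' C' -> susp (qhom a A E) e) :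
    (forall t, G t = re c *: H t + K t) ->
    epsum w G = re c *: epsum w H + epsum w K.
  by move=> GHK; rewrite -epsumZ -epsumD; apply: eq_epsum => t _.
have uE := epsum_lin _ _ u _ _ _ (fun u' =>
  fl _ _ e _ _ i u' (re c) (re x) (re y) (re_str v)).
have vE := epsum_lin _ _ v _ _ _ (fun v' =>
  fl _ _ e _ _ i (re_str u) (re c) (re x) (re y) v').
have [l lE] := slotlin_map (fl A E e) i (re_str u) (re_str v).
rewrite uE vE re_scat /=.
rewrite !lE !(linearD l) !linearZ !scalerDr /=.
(* Collect the multiples of re c, of ep c, and the terms in y. *)
by rewrite [LHS](AC (2*(3*2)) (((1*(3*6))*4)*(2*(5*7)))).
Qed.

Lemma dual_extend_homogeneous d (f : cochain a) :
  homogeneous d f -> homogeneous d (dual_extend f).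
Proof.
move=> fh A B x e xe; apply: dual_eq => /=; first by rewrite fh ?sdeg_re.
rewrite -[LHS]/(epsum x (fun y => f A B y e)).
rewrite -[RHS](epsum0 _ x); apply: eq_epsum => y E.
by rewrite fh // E.
Qed.

Lemma dual_extendD (f g : cochain a) :
  dual_extend (cochain_add f g) =
  cochain_add (dual_extend f) (dual_extend g).
Proof.
by apply: cochain_ext => A B x e; apply: dual_eq => //=; exact: big_split.
Qed.

Lemma dual_extend0 : dual_extend (cochain0 (a := a)) = cochain0.
Proof.
by apply: cochain_ext => A B x e; apply: dual_eq => //=; exact: big1_eq.
Qed.

(** The coefficients of [eps] agree because the factor of [w u v] that
    contributes [eps] lies in [w], in [u] or in [v]; on the right-hand side these
    are the contributions from the left of [g(u)], from [g(u)] itself and from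
    its right. *)
Lemma dual_extend_brace d (f g : cochain a) : multilinear f ->
  dual_extend (brace f [:: (d, g)]) =
  brace (dual_extend f) [:: (d, dual_extend g)].
Proof.
move=> /multilinearE fl; apply: cochain_ext => A B x e; rewrite braceE inssum1.
apply: dual_eq.
  rewrite /= braceE inssum1 re_cutsum cutsum_re; apply: eq_cutsum => C w r _.
  rewrite re_cutsum cutsum_re; apply: eq_cutsum => E u v _.
  rewrite ksign_dual /= sdeg_re re_scat /=; congr (_ *: f _ _ (scat _ _) _).
  by rewrite (@placeE _ _ d) ?sdeg_re.
rewrite ep_cutsum /= -[LHS]/(epsum x _).
under eq_epsum => y _ do rewrite braceE inssum1.
rewrite epsum_cutsum; apply: eq_cutsum => C w r _; rewrite ep_cutsum.
under eq_epsum => y _ do rewrite cutsum_re.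
rewrite epsum_cutsum_exchange epsum_cutsum -cutsumD.
apply: eq_cutsum => E u v _.
rewrite ksign_dual /= scale0r addr0 -[X in _ = _ *: X]/(epsum _ _).
rewrite epsum_cat epsum_cons /= sdeg_re 2!scalerDr -!epsumZ.
have [l lE] := slotlin_map (fl A B e) (sdeg u + d) (re_str w) (re_str v).
congr (_ + (_ + _)).
- apply: eq_epsum => w' ->; congr (_ *: f _ _ (scat _ _) _).
  by rewrite (@placeE _ _ d) ?sdeg_re.
- rewrite lE linear_epsum -epsumZ; apply: eq_epsum => u' Eu.
  by rewrite -lE (@placeE _ _ d) ?Eu.
- apply: eq_epsum => v' _; congr (_ *: f _ _ (scat _ _) _).
  by rewrite (@placeE _ _ d) ?sdeg_re.
Qed.

End DualStrings.

(** * Linear deformations along cocycles *)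

Section Deformation.
Variables (k : comPzRingType) (a : quiver k).

Lemma brace_zero d (f : cochain a) : multilinear f ->
  brace f [:: (d, cochain0)] = cochain0.
Proof.
move=> fl.
have z g : cochain0 = cochain_scale 0 g :> cochain a.
  by apply: cochain_ext => A B x e; rewrite /cochain_scale scale0r.
by rewrite {1}(z cochain0) brace_scaler // -z.
Qed.

Lemma brace_zerol L : brace cochain0 L = cochain0 :> cochain a.
Proof.
apply: cochain_ext => A B x e; rewrite /brace.
by apply: big1 => y _; rewrite scaler0.
Qed.

Lemma dHochE (m f : cochain a) :
  dHoch m 2 f = cochain_add (brace m [:: (1, f)]) (brace f [:: (1, m)]).
Proof.
apply: cochain_ext => A B x e.
by rewrite /dHoch /bracket /ksign expr1 scaleN1r opprK.
Qed.

Lemma epsilon2 : epsilon k * epsilon k = 0.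
Proof. by apply: dual_eq; rewrite /= ?mul0r ?mulr0 ?addr0. Qed.

Lemma deformed_multilinear (m f : cochain a) : multilinear m ->
  multilinear f -> multilinear (deformed_structure m f).
Proof.
move=> ml fl; apply: add_multilinear; last apply: scale_multilinear;
exact: dual_extend_multilinear.
Qed.

Lemma deformed_brace (m f : cochain a) d : multilinear m -> multilinear f ->
  brace (deformed_structure m f) [:: (d, deformed_structure m f)] =
  deformed_structure (brace m [:: (d, m)])
    (cochain_add (brace m [:: (d, f)]) (brace f [:: (d, m)])).
Proof.
move=> ml fl; have ml' := dual_extend_multilinear ml.
have fl' := dual_extend_multilinear fl.
rewrite /deformed_structure brace_addl brace_scalel !brace_addr //.
rewrite !brace_scaler // dual_extendD !dual_extend_brace //.
apply: cochain_ext => A B x e.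
rewrite /cochain_scale /cochain_add.
by rewrite !scalerDr scalerA epsilon2 scale0r addr0 addrA.
Qed.

Lemma deformation_cAinf (m f : cochain a) :
  cAinf_structure m -> Hoch_cocycle m 2 f ->
  cAinf_structure (deformed_structure m f).
Proof.
move=> [[ml mh] mm] [[fl fh] df]; split; last first.
  rewrite deformed_brace // mm -dHochE df.
  rewrite /deformed_structure !dual_extend0.
  apply: cochain_ext => A B x e.
  by rewrite /cochain_add /cochain_scale scaler0 addr0.
split; first exact: deformed_multilinear.
by apply: add_homogeneous; last apply: scale_homogeneous;
  exact: dual_extend_homogeneous.
Qed.

Lemma cocycleD (m f g : cochain a) : multilinear m ->
  Hoch_cocycle m 2 f -> Hoch_cocycle m 2 g ->
  Hoch_cocycle m 2 (cochain_add f g).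
Proof.
move=> ml [[fl fh] df] [[gl gh] dg]; split.
  by split; [exact: add_multilinear | exact: add_homogeneous].
move: df dg; rewrite !dHochE brace_addl brace_addr // => df dg.
apply: cochain_ext => A B x e.
have := congr1 (fun g : cochain _ => g A B x e) df.
have := congr1 (fun g : cochain _ => g A B x e) dg.
by rewrite /cochain_add addrACA => -> ->; exact: addr0.
Qed.

(** By [pre_Lie], [m{psi}{m} = m{psi, m} + m{m, psi}] since [psi{m} = 0], while
    [0 = m{m}{psi} = m{m, psi} + m{m{psi}} + m{psi, m}].  All signs are trivial
    since [psi] has degree 0. *)
Lemma zero_part_coboundary (m psi : cochain a) :
  cAinf_structure m -> multilinear psi -> brace psi [:: (1, m)] = cochain0 ->
  Hoch_cocycle m 2 (brace m [:: (0, psi)]).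
Proof.
move=> [[ml mh] mm] pl pm; split.
  split; first exact: brace1_multilinear.
  by have := brace1_homogeneous (d' := 0) psi mh; rewrite addr0.
have A1 := pre_Lie 0 1 psi m ml; have A2 := pre_Lie 1 0 m psi ml.
rewrite dHochE; apply: cochain_ext => A B x e.
move: A1 A2; rewrite pm mm brace_zero // brace_zerol => A1 A2.
have := congr1 (fun g : cochain _ => g A B x e) A2.
rewrite A1 /cochain_add /cochain_scale /cochain0 !add0r /= !mul0r !mulr0.
rewrite /ksign expr0 !scale1r => A2x.
by rewrite [RHS]A2x addrA addrC.
Qed.

(** Inserting a value always produces a nonempty string. *)
Lemma brace_of_zero_part (f : cochain a) d g :
  (forall (A B C : a) i (h : susp (qhom a B C) i) (s : str a A B) e,
     f A C (scons h s) e = 0) ->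
  brace f [:: (d, g)] = cochain0.
Proof.
move=> f0; apply: cochain_ext => A B x e; rewrite braceE inssum1.
rewrite -[RHS](cutsum0 _ x); apply: eq_cutsum => C w r _.
rewrite -[RHS](cutsum0 _ r); apply: eq_cutsum => E u v _.
suff cat0 i (h : susp (qhom a E C) i) : f A B (scat w (scons h v)) e = 0.
  by rewrite cat0 scaler0.
by case: w {r u} h => [?|? ? ? ? h' s] h /=; exact: f0.
Qed.

End Deformation.

Section Tautological.
Variables (k : comPzRingType) (a : quiver k).
Variable Psi : forall A : a, set (qhom a A A 1).

Lemma tautological_multilinear : multilinear (tautological (Psi := Psi)).
Proof.
move=> A B C D i u c x y v e.
by case: u x y => [?|? ? ? ? h s] x y /=; rewrite scaler0 addr0.
Qed.

End Tautological.

(** * Embracing by an element of square zero *)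

Section FirstOrderEmbrace.
Variables (k : comPzRingType) (a : quiver k) (c : k) (psi nu : cochain a).
Hypotheses (c2 : c * c = 0) (nul : multilinear nu).

Lemma embr_term_ge2 m : (2 <= m)%N ->
  embr_term (cochain_scale c psi) nu m = cochain0.
Proof.
case: m => [|[|m]] // _; rewrite /embr_term brace_scale2 // c2.
by apply: cochain_ext => A B x e; rewrite /cochain_scale scale0r.
Qed.

Lemma embraceable_first_order : embraceable (cochain_scale c psi) nu.
Proof.
move=> A B x e; apply: (sub_finite_set _ (finite_II 2)) => m /=.
by apply: contraNT; rewrite -leqNgt => m2; rewrite embr_term_ge2.
Qed.

Lemma embr_first_order :
  embr (cochain_scale c psi) nu =
  cochain_add nu (cochain_scale c (brace nu [:: (0, psi)])).
Proof.
apply: cochain_ext => A B x e; rewrite /embr -(fsbig_widen `I_2 [set: nat])//.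
  rewrite -fsbig_ord !big_ord_recl big_ord0 /= addr0.
  by rewrite /embr_term /= brace_nil brace_scaler.
move=> m [_ /= /negP]; rewrite -leqNgt => m2.
by rewrite /preimage /= embr_term_ge2.
Qed.

End FirstOrderEmbrace.

(** * The identification of the two deformations *)

Section Identification.
Variables (k : comPzRingType) (a : quiver k) (mu phi : cochain a).
Local Notation b := (psi_quiver (@all_psi k a)).
Local Notation psi := (@tautological k a (@all_psi k a)).
Local Notation iota := (@identification k a mu phi).
Local Notation Psi_eps := (@all_psi_eps k a).

Lemma identification_bij : bijective iota.
Proof.
pose inv (Q : psi_ob Psi_eps) : psi_ob (@all_psi k a) :=
  existT _ (projT1 Q) (exist _ (ep (proj1_sig (projT2 Q))) I).
exists inv; first by case=> A [y []].
case=> A [y Ay]; congr existT; apply: eq_exist.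
have yE : times_eps (ep y) = y by case: Ay => z _ <-.
exact: yE.
Qed.

Lemma push_re_str (P Q : dual_quiver b) (x : str (dual_quiver b) P Q) :
  re_str (push_str (p := @psi_base _ _ Psi_eps)
    (@push_str _ _ _ iota P Q x)) = push_str (re_str x).
Proof. by elim: x => //= P' Q' R i h s ->. Qed.

Lemma push_ep_str (P Q : dual_quiver b) (x : str (dual_quiver b) P Q) :
  ep_str (push_str (p := @psi_base _ _ Psi_eps)
    (@push_str _ _ _ iota P Q x)) = map (@push_str _ _ _ _ _ _) (ep_str x).
Proof.
elim: x => //= P' Q' R i h s ->; rewrite push_re_str -!map_comp.
done.
Qed.

Lemma pull_extended_deformation :
  pull_cochain iota (extended_deformation mu phi) =
  deformed_structure (psi_extend mu) (psi_extend phi)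
  :> cochain (dual_quiver b).
Proof.
apply: cochain_ext => P Q x e.
have pullE f : dual_extend f (push_str (p := @psi_base _ _ Psi_eps)
    (@push_str _ _ _ iota P Q x)) e = dual_extend (psi_extend f) x e.
  by apply: dual_eq; rewrite /= ?push_re_str // push_ep_str big_map.
exact: (congr2 (fun u v => u + epsilon k *: v) (pullE mu) (pullE phi)).
Qed.

Lemma pull_psi_eps :
  pull_cochain iota (@psi_eps k a) = cochain_scale (epsilon k) (dual_extend psi)
  :> cochain (dual_quiver b).
Proof.
apply: cochain_ext => P Q x e; apply: dual_eq.
  rewrite /= scale0r; case: x => [R|? ? ? ? h s] //=.
  (* Both sides are defined by matching on the degree e. *)
  by case: e => [[|n]|n].
rewrite /= scale0r add0r scale1r.
case: x => [R|? ? ? ? h s] //=.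
by case: e => [[|n]|n].
Qed.

End Identification.

Theorem proposition4p3 (k : comPzRingType) (a : quiver k) (mu phi : cochain a)
    (hmu : cAinf_structure mu) (hphi : Hoch_cocycle mu 2 phi) :
  [/\ is_cAinf (total_deformation mu phi),
      embraceable (@psi_eps k a) (extended_deformation mu phi),
      is_cAinf (twisted_deformation mu phi),
      bijective (@identification k a mu phi)
    & relabel (@identification k a mu phi) = total_deformation mu phi].
Proof.
set iota := @identification k a mu phi.
pose b := psi_quiver (@all_psi k a).
pose psi : cochain b := tautological (Psi := @all_psi k a).
pose M : cochain b := psi_extend mu.
pose Phi : cochain b := psi_extend phi.
have [[mul muh] mumu] := hmu; have [[phil phih] dphi] := hphi.
have Ml : multilinear M by exact: pull_multilinear.
have Phil : multilinear Phi by exact: pull_multilinear.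
have M_cAinf : cAinf_structure M.
  split; first by split=> //; exact: pull_homogeneous.
  by rewrite -[LHS](pull_brace _ mu [:: (1, mu)]) mumu.
have Phi_cocycle : Hoch_cocycle M 2 Phi.
  split; first by split=> //; exact: pull_homogeneous.
  rewrite dHochE -(pull_brace _ mu [:: (1, phi)]).
  rewrite -(pull_brace _ phi [:: (1, mu)]).
  by rewrite dHochE in dphi; apply: cochain_ext => P Q x e;
     exact: (congr1 (fun f : cochain a => f _ _ (push_str x) e) dphi).
have total_cAinf : is_cAinf (total_deformation mu phi).
  apply: deformation_cAinf => //; apply: cocycleD => //.
  apply: zero_part_coboundary => //; first exact: tautological_multilinear.
  exact: brace_of_zero_part.
have iota_bij : bijective iota := identification_bij mu phi.
have iota_surj A : exists P, iota P = A.
  by have [j _ jK] := iota_bij; exists (j A).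
have Nl : multilinear (deformed_structure M Phi) by exact: deformed_multilinear.
have embrE : pull_cochain iota (structure (twisted_deformation mu phi)) =
    structure (total_deformation mu phi) :> cochain (dual_quiver b).
  transitivity (embr (cochain_scale (epsilon k) (dual_extend psi))
    (deformed_structure M Phi)).
    rewrite -(pull_psi_eps mu phi) -pull_extended_deformation.
    apply: cochain_ext => P Q x e.
    by apply: eq_fsbigr => m _;
      exact: (@embr_term_push _ _ _ iota).
  rewrite embr_first_order //; last exact: epsilon2.
  rewrite /deformed_structure brace_addl brace_scalel.
  rewrite -dual_extend_brace // -[structure _]/(deformed_structure M _).
  rewrite /deformed_structure /total_cocycle dual_extendD.
  apply: cochain_ext => P Q x e; rewrite /cochain_add /cochain_scale.
  rewrite !scalerDr scalerA epsilon2 scale0r addr0.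
  by rewrite addrA.
split=> //.
- move=> A B x e.
  case: A B x / (str_lifted iota_surj x) => P Q x.
  have := embraceable_first_order (dual_extend psi) (epsilon2 k) Nl x e.
  rewrite -(pull_psi_eps mu phi) -pull_extended_deformation.
  apply: sub_finite_set => m /=.
  by rewrite embr_term_push.
- apply: (cAinf_of_pull iota_surj); rewrite [pull_cochain _ _]embrE.
  exact: total_cAinf.
- exact: (congr1 (@StructuredQuiver _ (dual_quiver b)) embrE).
Qed.
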